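(* Let $2\le p\le q\le r$ be integers and let $A=(a_{ijk})$ be a hypermatrix of format $(p,q,r)$ with entries in $\mathbb{C}$, with associated determinantal schemes $\mathcal L\subset\mathbb{P}^{p-1}$, $\mathcal M\subset\mathbb{P}^{q-1}$, $\mathcal N\subset\mathbb{P}^{r-1}$. If in one of the three schemes $\mathcal L$, $\mathcal M$, $\mathcal N$ there is a degenerate point which is not bi-degenerate, then there is a point $(P,Q,T)\in K_A$, i.e. $A$ is degenerate (so, if $r\le p+q-1$, then $\mathrm{Det}(A)=0$).
   Context: A hypermatrix of format $(p,q,r)$ is a family $A=(a_{ijk})$, $1\le i\le p$, $1\le j\le q$, $1\le k\le r$, of complex numbers. Kernel and degeneracy of $A$: $K_A$ is the set of triples $(P,Q,T)\in\mathbb{P}^{p-1}\times\mathbb{P}^{q-1}\times\mathbb{P}^{r-1}$ with coordinates $(x_i),(y_j),(z_k)$ such that $\sum_{i,j}a_{ijk}x_iy_j=0$ for all $k$, $\sum_{i,k}a_{ijk}x_iz_k=0$ for all $j$, and $\sum_{j,k}a_{ijk}y_jz_k=0$ for all $i$. $A$ is degenerate if $K_A\neq\emptyset$. Associated matrices of linear forms: $L=(L_{jk})$ is $q\times r$ with $L_{jk}=\sum_i a_{ijk}x_i$; $M=(M_{ik})$ is $p\times r$ with $M_{ik}=\sum_j a_{ijk}y_j$; $N=(N_{ij})$ is $p\times q$ with $N_{ij}=\sum_k a_{ijk}z_k$. The associated schemes $\mathcal L\subset\mathbb{P}^{p-1}$, $\mathcal M\subset\mathbb{P}^{q-1}$,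 $\mathcal N\subset\mathbb{P}^{r-1}$ are the schemes defined by the ideals generated by the maximal minors of $L,M,N$ respectively. Degenerate points: let $u\le v$, let $B$ be a $u\times v$ matrix of linear forms in $n$ variables, and let $\mathcal S\subseteq\mathbb{P}^{n-1}$ be the scheme defined by the $u\times u$ minors of $B$. For $P\in\mathcal S$ let $J_{\mathcal S}(P)$ be the $\binom{v}{u}\times n$ Jacobian matrix of these minors evaluated at $P$. The point $P\in\mathcal S$ is a degenerate point of $\mathcal S$ if $\operatorname{rk}J_{\mathcal S}(P)<\min\{v-u+1,n\}$; it is bi-degenerate if all $(u-1)\times(u-1)$ minors of $B$ vanish at $P$. These notions are applied to $\mathcal L,\mathcal M,\mathcal N$ with $B=L,M,N$ respectively. Hyperdeterminant: let $\mathbb{V}\subset(\mathbb{P}^{pqr-1})^*$ be the dual variety of the Segre variety $\mathbb{P}^{p-1}\times\mathbb{P}^{q-1}\times\mathbb{P}^{r-1}\subset\mathbb{P}^{pqr-1}$ (coordinates $w_{ijk}$). For $2\le p\le q\le r$ it is a hypersurface exactly when $r\le p+q-1$; in that case let $D$ be a generator of its ideal and set $\mathrm{Det}(A)=D(H_A)$, where $H_A$ is the hyperplane $\sum a_{ijk}w_{ijk}=0$ (only the vanishing of $\mathrm{Det}(A)$ is meaningful). It is a known theorem of Gelfand–Kapranov–Zelevinsky that, for $r\le p+q-1$, $A$ is degenerate if and only if $\mathrm{Det}(A)=0$. *)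

(* Defs.v *)
From HB Require Import structures.
From mathcomp Require Import all_boot all_order all_algebra.
From mathcomp Require Import mpoly.
From mathcomp Require Export complex.
From mathcomp Require Export reals.

Set Implicit Arguments.
Unset Strict Implicit.
Unset Printing Implicit Defensive.

Import GRing.Theory.
Local Open Scope ring_scope.

(* Points of P^(n-1) are given by nonzero coordinate vectors in F^n, and       *)
(* subsets of P^(n-1) by predicates on F^n that are invariant under nonzero    *)
(* scaling and hold only on nonzero vectors.                                   *)

Section ProjectiveSets.
Variables (F : fieldType) (n : nat).
Implicit Types (X : 'rV[F]_n -> Prop) (f D : {mpoly F[n]}).

Definition in_vanishing_ideal X f : Prop := forall x, X x -> f.@[x 0] = 0.

Definition zariski_closure X (x : 'rV[F]_n) : Prop :=
  x != 0 /\ forall f, in_vanishing_ideal X f -> f.@[x 0] = 0.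

(* The linear subspace of F^n whose projectivization is the embedded           *)
(* projective tangent space of X at x.                                         *)
Definition tangent_space X (x v : 'rV[F]_n) : Prop :=
  forall f, in_vanishing_ideal X f -> \sum_(l < n) (f^`M(l)).@[x 0] * v 0 l = 0.

(* The nonzero vector h stands for the hyperplane \sum_l h_l w_l = 0.          *)
Definition tangent_hyperplane X (h : 'rV[F]_n) : Prop :=
  h != 0 /\
  exists2 x, X x & forall v, tangent_space X x v -> \sum_(l < n) h 0 l * v 0 l = 0.

(* For a general X only the hyperplanes tangent at smooth points count; this   *)
(* definition is meant for smooth X, such as the Segre variety.                *)
Definition dual_variety X : 'rV[F]_n -> Prop :=
  zariski_closure (tangent_hyperplane X).

Definition generates_ideal_of X D : Prop :=
  forall f, in_vanishing_ideal X f <-> exists g, f = g * D.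

End ProjectiveSets.

Section DeterminantalSchemes.
Variables (F : fieldType) (n u v : nat) (B : 'M[{mpoly F[n]}]_(u, v)).

(* The k-subsets of 'I_m, as increasing sequences; there are 'C(m, k) of them  *)
(* by card_ltn_sorted_tuples.                                                  *)
Definition subseqs (k m : nat) : {set k.-tuple 'I_m} :=
  [set t : k.-tuple 'I_m | sorted ltn (map val t)].

Definition minor k (s : k.-tuple 'I_u) (t : k.-tuple 'I_v) : {mpoly F[n]} :=
  \det (mxsub (tnth s) (tnth t) B).

Definition maximal_minor (t : u.-tuple 'I_v) : {mpoly F[n]} :=
  minor (ord_tuple u) t.

Definition in_scheme (P : 'rV[F]_n) : Prop :=
  P != 0 /\ forall t, t \in subseqs u v -> (maximal_minor t).@[P 0] = 0.

Definition jacobian (P : 'rV[F]_n) : 'M[F]_(#|subseqs u v|, n) :=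
  \matrix_(a, l) ((maximal_minor (enum_val a))^`M(l)).@[P 0].

Definition degenerate_point (P : 'rV[F]_n) : Prop :=
  in_scheme P /\ (\rank (jacobian P) < minn (v - u + 1) n)%N.

Definition bidegenerate_point (P : 'rV[F]_n) : Prop :=
  in_scheme P /\
  forall s t, s \in subseqs (u - 1) u -> t \in subseqs (u - 1) v ->
    (minor s t).@[P 0] = 0.

End DeterminantalSchemes.

Definition hypermatrix (F : Type) (p q r : nat) := 'I_p -> 'I_q -> 'I_r -> F.

Section Hypermatrices.
Variables (F : fieldType) (p q r : nat).
Implicit Type A : hypermatrix F p q r.

Definition kernel A (x : 'rV[F]_p) (y : 'rV[F]_q) (z : 'rV[F]_r) : Prop :=
  [/\ x != 0, y != 0 & z != 0] /\
  [/\ forall k, \sum_(i < p) \sum_(j < q) A i j k * x 0 i * y 0 j = 0,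
      forall j, \sum_(i < p) \sum_(k < r) A i j k * x 0 i * z 0 k = 0 &
      forall i, \sum_(j < q) \sum_(k < r) A i j k * y 0 j * z 0 k = 0].

Definition degenerate A : Prop := exists x y z, kernel A x y z.

Definition matL A : 'M[{mpoly F[p]}]_(q, r) :=
  \matrix_(j, k) \sum_(i < p) A i j k *: 'X_i.

Definition matM A : 'M[{mpoly F[q]}]_(p, r) :=
  \matrix_(i, k) \sum_(j < q) A i j k *: 'X_j.

Definition matN A : 'M[{mpoly F[r]}]_(p, q) :=
  \matrix_(i, j) \sum_(k < r) A i j k *: 'X_k.

(* The dimension p * q * r of the ambient space, in a form whose ordinals      *)
(* enumerate the triples (i, j, k).                                            *)
Definition ambient_dim : nat := #|{: 'I_p * 'I_q * 'I_r}|.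

Definition flatten_hypermatrix A : 'rV[F]_ambient_dim :=
  \row_l (let: (i, j, k) := enum_val l in A i j k).

Definition segre (w : 'rV[F]_ambient_dim) : Prop :=
  exists (x : 'rV[F]_p) (y : 'rV[F]_q) (z : 'rV[F]_r),
    [/\ x != 0, y != 0 & z != 0] /\
    w = flatten_hypermatrix (fun i j k => x 0 i * y 0 j * z 0 k).

(* The hyperdeterminant is determined up to a nonzero scalar.                  *)
Definition is_hyperdeterminant (D : {mpoly F[ambient_dim]}) : Prop :=
  generates_ideal_of (dual_variety segre) D.

(* The value of D at the hyperplane \sum a_ijk w_ijk = 0.                      *)
Definition Det (D : {mpoly F[ambient_dim]}) A : F :=
  D.@[flatten_hypermatrix A 0].

End Hypermatrices.

(* Main.v *)
(** Suppose that B(P) has corank one but P is a degenerate point, and let y span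
    the left kernel of B(P).  If u - 1 columns t of B(P) are independent, then
    for every column c the adjugate of the square block on the columns c :: t
    is z_c y, where the column z_c extends by zero to a vector Z_c of the right
    kernel of B(P).  By Jacobi's formula the gradient at P of the corresponding
    minor is x |-> y B(x) Z_c.  The Z_c with c outside t are independent and
    there are v - u + 1 of them, so the rank condition on the Jacobian gives a
    nonzero combination Z with y B(x) Z = 0 for all x, and (P, y, Z) is a point
    of the kernel.  Then the hyperplane of A is tangent to the Segre variety at
    that point, hence it lies in the dual variety. *)

Require Import Defs.
From mathcomp Require Import all_boot all_order all_fingroup all_algebra.
From mathcomp Require Import mpoly ring.

Set Implicit Arguments.
Unset Strict Implicit.
Unset Printing Implicit Defensive.

Import GRing.Theory.
Local Open Scope ring_scope.

(** * Derivatives of determinants *)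

Lemma mderiv_prod (R : comNzRingType) (n : nat) (l : 'I_n) (I : eqType)
    (r : seq I) (f : I -> {mpoly R[n]}) :
  uniq r ->
  (\prod_(i <- r) f i)^`M(l) =
    \sum_(i <- r) (f i)^`M(l) * \prod_(j <- r | i != j) f j.
Proof.
elim: r => [|a r IHr] /=; first by rewrite !big_nil mderivC.
case/andP=> a_r uniq_r; rewrite !big_cons mderivM IHr // eqxx /=.
congr (_ * _ + _).
  rewrite big_seq [RHS]big_seq_cond; apply: eq_bigl => j.
  by case: (boolP (j \in r)) => //= j_r; apply/esym; apply: contraNneq a_r => ->.
rewrite mulr_sumr !big_seq; apply: eq_bigr => i i_r.
rewrite big_cons ifT; last by apply: contraNneq a_r => <-.
by rewrite mulrCA.
Qed.

(** Jacobi's formula: the Leibniz expansion is differentiated factor by factor, and the permutations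
    are grouped by their value at [i]. *)
Lemma mderiv_det (R : comNzRingType) (n k : nat) (l : 'I_n)
    (M : 'M[{mpoly R[n]}]_k) :
  (\det M)^`M(l) = \sum_i \sum_j (M i j)^`M(l) * cofactor M i j.
Proof.
rewrite [\det M]/determinant raddf_sum /=.
under [RHS]eq_bigr => i _ do under eq_bigr => j _ do
  rewrite expand_cofactor mulr_sumr.
transitivity (\sum_(s : 'S_k) \sum_i (-1) ^+ s *
    ((M i (s i))^`M(l) * \prod_(j | i != j) M j (s j))).
  apply: eq_bigr => s _.
  rewrite -mulr_sumr -mderiv_prod ?index_enum_uniq //.
  by rewrite !mulr_sign; case: ifP; rewrite ?raddfN.
rewrite exchange_big; apply: eq_bigr => i _ /=.
rewrite (partition_big (fun s : 'S_k => s i) xpredT) //=.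
apply: eq_bigr => j _; apply: eq_bigr => s /eqP <-.
by rewrite mulrCA.
Qed.

Lemma meval_mderiv_det (F : fieldType) (n k : nat) (l : 'I_n)
    (M : 'M[{mpoly F[n]}]_k) (P : 'rV[F]_n) :
  ((\det M)^`M(l)).@[P 0] =
    \tr (\adj (map_mx (meval (P 0)) M) *m
         map_mx (fun f : {mpoly F[n]} => (f^`M(l)).@[P 0]) M).
Proof.
rewrite mderiv_det raddf_sum /mxtrace /=.
transitivity (\sum_i \sum_j
    ((M i j)^`M(l)).@[P 0] * (cofactor M i j).@[P 0]).
  apply: eq_bigr => i _; rewrite raddf_sum; apply: eq_bigr => j _.
  by rewrite /= mevalM.
rewrite exchange_big; apply: eq_bigr => j _ /=.
rewrite mxE; apply: eq_bigr => i _.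
by rewrite !mxE cofactor_map_mx mulrC.
Qed.

(** * Minors, cofactors and adjugates *)

Lemma colsub_sorted_perm (k m : nat) (g : 'I_k -> 'I_m) :
  injective g ->
  exists2 t, t \in subseqs k m &
    exists s : 'S_k, forall i, g i = tnth t (s i).
Proof.
move=> g_inj.
pose e := sort (relpre val leq) (codom g).
have size_e : size e == k by rewrite size_sort size_codom card_ord.
have uniq_e : uniq e by rewrite sort_uniq; apply/injectiveP.
exists (Tuple size_e).
  rewrite inE /= ltn_sorted_uniq_leq (map_inj_uniq val_inj) uniq_e /=.
  by rewrite sorted_map sort_sorted // => i j /=; apply: leq_total.
have /tuple_permP[s def_g] : perm_eq [seq g i | i <- enum 'I_k] (Tuple size_e).
  by rewrite perm_sym /= perm_sort.
exists s => i.
have := congr1 (fun w => nth (g i) w i) def_g.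
rewrite (nth_map i) ?size_enum_ord // nth_ord_enum => ->.
by rewrite -[LHS]tnth_nth tnth_mktuple.
Qed.

(** Repeated columns give zero; otherwise sorting the columns costs only a sign. This links the
    unsorted lists [c :: t] to the increasing tuples that index the Jacobian. *)
Lemma det_colsub_maximal_minor (F : fieldType) (n u v : nat)
    (B : 'M[{mpoly F[n]}]_(u, v)) (g : 'I_u -> 'I_v) :
  \det (colsub g B) = 0 \/
  exists2 t, t \in subseqs u v &
    exists b : bool, \det (colsub g B) = (-1) ^+ b * maximal_minor B t.
Proof.
case: (boolP (injectiveb g)) => [/injectiveP g_inj | /injectivePn].
  right; have [t t_sub [s def_g]] := colsub_sorted_perm g_inj.
  exists t => //; exists s.
  have -> : colsub g B = colsub (tnth t) B *m perm_mx s^-1.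
    by rewrite -col_permE; apply/matrixP => i j; rewrite !mxE def_g.
  rewrite det_mulmx det_perm mulrC odd_permV /maximal_minor /minor.
  congr (_ * \det _).
  by apply/matrixP => i j; rewrite !mxE tnth_ord_tuple.
case=> i [j i_neq_j gij]; left.
rewrite -det_tr; apply: (determinant_alternate i_neq_j) => a.
by rewrite !mxE gij.
Qed.

(** Some index [i] is missed by [f], so the chosen rows factor through [row' i E]. This trades a
    tuple of rows for a deleted row, as in cofactors. *)
Lemma row'_det_neq0 (F : fieldType) (k : nat) (f : 'I_k -> 'I_k.+1)
    (E : 'M[F]_(k.+1, k)) :
  \det (rowsub f E) != 0 -> exists i, \det (row' i E) != 0.
Proof.
have [i f_i] : exists i, i \notin codom f.
  apply/existsP; rewrite -negb_forall; apply/negP => /forallP f_onto.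
  have := leq_image_card f 'I_k; rewrite card_ord.
  have /eq_card -> : image f 'I_k =i 'I_k.+1 by move=> j; rewrite f_onto.
  by rewrite card_ord ltnn.
move=> det_neq0; exists i; apply: contraNneq det_neq0 => det_eq0.
have unlift_f a : {b | f a = lift i b}.
  have [|b ->] := @unlift_some _ i (f a); last by exists b.
  by apply: contraNneq f_i => ->; apply: codom_f.
pose h a := sval (unlift_f a).
have -> : rowsub f E = rowsub h 1%:M *m row' i E.
  by rewrite -rowsubE; apply/matrixP => a b; rewrite !mxE (svalP (unlift_f a)).
by rewrite det_mulmx det_eq0 mulr0.
Qed.

(** The rows of [\adj C] lie in the left kernel of [C], which is a line because the nonzero cofactor
    forces rank [k]; so they are multiples of row 0. Cancelling entry [i] of row 0 gives the two
    equations on [z]. *)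
Lemma adj_corank1 (F : fieldType) (k : nat) (C : 'M[F]_k.+1) (i : 'I_k.+1) :
  \det C = 0 -> cofactor C i 0 != 0 ->
  exists z : 'cV[F]_k.+1,
    [/\ \adj C = z *m row 0 (\adj C), z 0 0 = 1 & C *m z = 0].
Proof.
move=> detC0 cof_neq0; set y := row 0 (\adj C).
have y_i : y 0 i != 0 by rewrite !mxE.
have y_neq0 : y != 0 by apply: contraNneq y_i => ->; rewrite mxE.
have adj_ker : (\adj C <= kermx C)%MS.
  by apply/sub_kermxP; rewrite mul_adj_mx detC0 raddf0.
have rankC : (k <= \rank C)%N.
  have rank_minor : \rank (row' i (col' 0 C)) = k.
    apply: mxrank_unit; rewrite unitmxE unitfE.
    by apply: contraNneq cof_neq0 => det0; rewrite /cofactor det0 mulr0.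
  rewrite -[leqLHS]rank_minor.
  have -> : row' i (col' 0 C) =
      rowsub (lift i) 1%:M *m (C *m colsub (lift 0) 1%:M).
    by rewrite -rowsubE mulmx_colsub mulmx1; apply/matrixP => a b; rewrite !mxE.
  exact: leq_trans (mxrankM_maxr _ _) (mxrankM_maxl _ _).
have ker_y : (kermx C <= y)%MS.
  have y_ker : (y <= kermx C)%MS by rewrite (submx_trans (row_sub _ _)).
  rewrite -(geq_leqif (mxrank_leqif_sup y_ker)) mxrank_ker rank_rV y_neq0.
  by rewrite leq_subLR addn1 ltnS.
have /submxP[z def_z] := submx_trans adj_ker ker_y.
exists z; split=> //.
  apply/(mulIf y_i); rewrite mul1r.
  have := congr1 (fun M : 'M_k.+1 => M 0 i) def_z.
  by rewrite [RHS]mxE big_ord1 => <-; rewrite [RHS]mxE.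
have : C *m z *m y = 0 by rewrite -mulmxA -def_z mul_mx_adj detC0 raddf0.
move/matrixP => Czy0; apply/matrixP => a b; rewrite ord1 [RHS]mxE.
apply/(mulIf y_i); rewrite mul0r.
by have := Czy0 a i; rewrite [LHS]mxE big_ord1 [RHS]mxE.
Qed.

Lemma mxrank_row_mx (F : fieldType) (m n1 n2 : nat) (A : 'M[F]_(m, n1))
    (B : 'M[F]_(m, n2)) :
  (\rank (row_mx A B) <= \rank A + \rank B)%N.
Proof.
rewrite -mxrank_tr tr_row_mx -addsmxE -(mxrank_tr A) -(mxrank_tr B).
exact: mxrank_adds_leqif.
Qed.

(** * Kernel vectors at a degenerate point of corank one *)

Section DegeneratePoint.
Variables (F : fieldType) (n k v : nat) (B : 'M[{mpoly F[n]}]_(k.+1, v)).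
Variables (P : 'rV[F]_n) (s : k.-tuple 'I_k.+1) (t : k.-tuple 'I_v).
Hypothesis le_kv : (k < v)%N.
Hypothesis degP : degenerate_point B P.
Hypothesis minor_neq0 : (minor B s t).@[P 0] != 0.

Let B0 := map_mx (meval (P 0)) B.
Let dB l := map_mx (fun f : {mpoly F[n]} => (f^`M(l)).@[P 0]) B.

(** The list [c :: t]: with [c] at index 0, the cofactors along column 0 do not depend on [c]. *)
Let cols (c : 'I_v) (a : 'I_k.+1) : 'I_v := oapp (tnth t) c (unlift 0 a).

Let cols0 c : cols c 0 = c.
Proof. by rewrite /cols unlift_none. Qed.

Let colsS c a : cols c (lift 0 a) = tnth t a.
Proof. by rewrite /cols liftK. Qed.

Let det_cols c : \det (colsub (cols c) B0) = 0.
Proof.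
have -> : colsub (cols c) B0 = map_mx (meval (P 0)) (colsub (cols c) B).
  by rewrite map_mxsub.
rewrite det_map_mx /=.
case: (det_colsub_maximal_minor B (cols c)) => [-> | [t' t'_sub [b ->]]].
  exact: meval0.
by have [[_ minors0] _] := degP; rewrite mevalM minors0 ?mulr0.
Qed.

Let grad := \matrix_(c < v, l < n) ((\det (colsub (cols c) B))^`M(l)).@[P 0].

Let grad_sub : (grad <= jacobian B P)%MS.
Proof.
apply/row_subP => c.
case: (det_colsub_maximal_minor B (cols c)) => [det0 | [t' t'_sub [b def_det]]].
  have -> : row c grad = 0; last exact: sub0mx.
  by apply/rowP => l; rewrite !mxE det0 raddf0 meval0.
have -> : row c grad = (-1) ^+ b *: row (enum_rank_in t'_sub t') (jacobian B P).
  apply/rowP => l; rewrite !mxE def_det enum_rankK_in // !mulr_sign.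
  by case: ifP => // _; rewrite raddfN mevalN.
exact/scalemx_sub/row_sub.
Qed.

(* A linear relation between the gradients of the minors on the columns
   [c :: t], supported on the [c] outside [t]. *)
Let exists_relation :
  exists2 lam : 'rV[F]_v, lam != 0 &
    lam *m grad = 0 /\ forall a, lam 0 (tnth t a) = 0.
Proof.
(* The [k] extra columns force [lam] to vanish on [t]. Since [u = k + 1], the Jacobian has rank
   below [v - k], so [G] has rank below [v]. *)
pose G := row_mx grad (colsub (tnth t) 1%:M).
have rankG : (\rank G < v)%N.
  apply: leq_ltn_trans (mxrank_row_mx _ _) _.
  have rank_grad : (\rank grad < v - k)%N.
    apply: leq_ltn_trans (mxrankS grad_sub) _.
    have [_] := degP; rewrite leq_min => /andP[+ _].
    by rewrite subnS addn1 prednK // subn_gt0.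
  have := rank_leq_col (colsub (tnth t) 1%:M : 'M[F]_(v, k)).
  by rewrite -(ltn_add2r k) subnK ?(ltnW le_kv) // in rank_grad;
     rewrite -(leq_add2l (\rank grad)) => /leq_ltn_trans ->.
have /rowV0Pn[lam] : kermx G != 0.
  by rewrite -mxrank_eq0 mxrank_ker subn_eq0 -ltnNge.
move/sub_kermxP; rewrite mul_mx_row -[X in _ = X]row_mx0.
case/eq_row_mx => lam_grad lam_t lam_neq0; exists lam => //; split=> // a.
have := congr1 (fun w : 'rV_k => w 0 a) lam_t.
by rewrite mulmx_colsub mulmx1 !mxE.
Qed.

(** When [B] consists of linear forms, [dB l] is its coefficient matrix at variable [l], and the
    three equations put [(P, y, w)] in the kernel. *)
Lemma degenerate_point_kernel :
  exists2 y : 'rV[F]_k.+1, y != 0 &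
  exists2 w : 'cV[F]_v, w != 0 &
    [/\ y *m B0 = 0, B0 *m w = 0 & forall l, y *m dB l *m w = 0].
Proof.
pose E := colsub (tnth t) B0.
have [i Ei] : exists i, \det (row' i E) != 0.
  apply: (@row'_det_neq0 _ _ (tnth s)).
  suff -> : rowsub (tnth s) E = map_mx (meval (P 0)) (mxsub (tnth s) (tnth t) B).
    by rewrite det_map_mx.
  by apply/matrixP => a b; rewrite !mxE.
(* The common column of cofactors of all the blocks [c :: t]. *)
pose y := \row_a ((-1) ^+ a * \det (row' a E)).
have cof_y c a : cofactor (colsub (cols c) B0) a 0 = y 0 a.
  rewrite mxE /cofactor addn0; congr (_ * \det _).
  by apply/matrixP => b d; rewrite !mxE colsS.
have row_y c : row 0 (\adj (colsub (cols c) B0)) = y.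
  by apply/rowP => a; rewrite -(cof_y c) !mxE.
have y_i : y 0 i != 0 by rewrite mxE mulf_eq0 signr_eq0.
have /fin_all_exists[z z_P] c : exists z : 'cV[F]_k.+1,
    [/\ \adj (colsub (cols c) B0) = z *m y,
        z 0 0 = 1 & colsub (cols c) B0 *m z = 0].
  by rewrite -(row_y c); apply: (@adj_corank1 _ _ _ i); rewrite ?cof_y.
have [lam lam_neq0 [lam_grad lam_t]] := exists_relation.
pose Z c := colsub (cols c) 1%:M *m z c.
have mulZ m (X : 'M[F]_(m, v)) c : X *m Z c = colsub (cols c) X *m z c.
  by rewrite mulmxA mulmx_colsub mulmx1.
exists y; first by apply: contraNneq y_i => ->; rewrite mxE.
exists (\sum_c lam 0 c *: Z c).
  (* Such a [c] lies outside [t], so only [Z c] has a nonzero coordinate at [c], namely 1, and the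
     combination has coordinate [lam 0 c] there. *)
  have [c lam_c] : exists c, lam 0 c != 0 by apply/rV0Pn.
  have c_t a : (c == tnth t a) = false.
    by apply: contraNF lam_c => /eqP->; rewrite lam_t.
  have Zc d : Z d c 0 = (c == d)%:R.
    rewrite mxE big_ord_recl big1 => [|a _]; last by rewrite !mxE colsS c_t mul0r.
    by have [_ -> _] := z_P d; rewrite !mxE cols0 mulr1 addr0.
  apply: contraNneq lam_c => /matrixP /(_ c 0); rewrite [RHS]mxE summxE.
  rewrite (bigD1 c) //= big1 => [|d d_c].
    by rewrite mxE Zc eqxx mulr1 addr0 => ->.
  by rewrite mxE Zc eq_sym (negPf d_c) mulr0.
split.
(* Entry [c] of [y *m B0] is the Laplace expansion of the vanishing block determinant along column
   0. *)
- apply/rowP => c; rewrite [RHS]mxE.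
  transitivity (\det (colsub (cols c) B0)); last exact: det_cols.
  rewrite (expand_det_col _ 0) mxE; apply: eq_bigr => a _.
  by rewrite cof_y mulrC [colsub _ _ _ _]mxE cols0.
- rewrite mulmx_sumr big1 // => c _; rewrite -scalemxAr mulZ.
  by have [_ _ ->] := z_P c; rewrite scaler0.
(* By Jacobi's formula and [\adj = z c *m y], this is coordinate [l] of [lam *m grad]. *)
move=> l; apply/matrixP => a b; rewrite !ord1 [RHS]mxE.
have := congr1 (fun x : 'rV_n => x 0 l) lam_grad; rewrite [RHS]mxE => <-.
rewrite mulmx_sumr summxE mxE; apply: eq_bigr => c _.
rewrite -scalemxAr [LHS]mxE [grad _ _]mxE meval_mderiv_det !map_mxsub.
have [-> _ _] := z_P c.
by rewrite -[in RHS]mulmxA mxtrace_mulC trace_mx11 mulZ -mulmx_colsub.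
Qed.

End DegeneratePoint.

(** * From degenerate points to points of the kernel *)

Lemma mderivXU (R : comNzRingType) (n : nat) (i l : 'I_n) :
  ('X_i : {mpoly R[n]})^`M(l) = (i == l)%:R.
Proof.
rewrite mderivX mnm1E; case: eqP => [-> | _]; last by rewrite scale0r.
rewrite scale1r -mpolyX0; congr mpolyX.
by apply/mnmP => j; rewrite mnmBE subnn mnm0E.
Qed.

(** The free format lets permuted hypermatrices cover all three schemes. The nonzero entry ensures
    that [A] defines a hyperplane. *)
Lemma degenerate_matL (F : fieldType) (n u v : nat)
    (A : hypermatrix F n u v) (P : 'rV[F]_n) :
  (2 <= u <= v)%N ->
  degenerate_point (matL A) P -> ~ bidegenerate_point (matL A) P ->
  degenerate A /\ exists i j k, A i j k != 0.
Proof.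
case: u A => // k A /andP[k_gt0 le_kv] degP not_bideg.
have P_neq0 : P != 0 by case: degP => [[]].
have [s [t minor_neq0]] : exists (s : k.-tuple 'I_k.+1) (t : k.-tuple 'I_v),
    (minor (matL A) s t).@[P 0] != 0.
  case: (boolP [exists s : k.-tuple 'I_k.+1, [exists t : k.-tuple 'I_v,
      (minor (matL A) s t).@[P 0] != 0]]) => [/existsP[s /existsP[t st]] | no_st].
    by exists s, t.
  case: not_bideg; split; first by case: degP.
  rewrite subn1 /= => s t _ _; apply: contraNeq no_st => st.
  by apply/existsP; exists s; apply/existsP; exists t.
split.
  have [y y_neq0 [w w_neq0 [yB Bw ydBw]]] :=
    degenerate_point_kernel le_kv degP minor_neq0.
  exists P, y, w^T; split.
    by split=> //; apply: contraNneq w_neq0 => w0; rewrite -[w]trmxK w0 trmx0.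
  have evalB j l : (matL A j l).@[P 0] = \sum_i A i j l * P 0 i.
    rewrite mxE raddf_sum; apply: eq_bigr => i _.
    by rewrite /= mevalZ mevalXU.
  split.
  - move=> l; have := congr1 (fun x : 'rV_v => x 0 l) yB.
    rewrite !mxE => eq0; rewrite -[RHS]eq0 exchange_big; apply: eq_bigr => j _ /=.
    by rewrite mxE evalB mulr_sumr; apply: eq_bigr => i _; rewrite mulrC.
  - move=> j; have := congr1 (fun x : 'cV_k.+1 => x j 0) Bw.
    rewrite !mxE => eq0; rewrite -[RHS]eq0 exchange_big; apply: eq_bigr => l _ /=.
    by rewrite [map_mx _ _ _ _]mxE evalB mulr_suml; apply: eq_bigr => i _; rewrite mxE.
  move=> i; have := congr1 (fun x : 'M_1 => x 0 0) (ydBw i).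
  rewrite !mxE => eq0; rewrite -[RHS]eq0 exchange_big; apply: eq_bigr => l _ /=.
  rewrite [(y *m _) _ _]mxE mulr_suml; apply: eq_bigr => j _; rewrite !mxE.
  rewrite [_^`M(i)]raddf_sum raddf_sum (bigD1 i) //= big1 => [|m m_i].
    by rewrite addr0 mderivZ mderivXU eqxx mevalZ meval1 mulr1 [A _ _ _ * _]mulrC.
  by rewrite mderivZ mderivXU (negPf m_i) mevalZ meval0 mulr0.
have [/existsP[i /existsP[j /existsP[l Aijl]]] | A0] :=
  boolP [exists i, exists j, exists l, A i j l != 0]; first by exists i, j, l.
(* If [A] were zero, this minor would vanish, its order [k = u - 1] being positive. *)
case/eqP: minor_neq0; suff -> : minor (matL A) s t = 0 by rewrite meval0.
rewrite /minor; suff -> : mxsub (tnth s) (tnth t) (matL A) = 0.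
  by case: (k) k_gt0 => // k' _; rewrite det0.
apply/matrixP => j l; rewrite !mxE big1 // => i _.
have [-> | Aijl] := eqVneq (A i (tnth s j) (tnth t l)) 0; first exact: scale0r.
case/negP: A0; apply/existsP; exists i; apply/existsP; exists (tnth s j).
by apply/existsP; exists (tnth t l).
Qed.

(** * Tangent hyperplanes of the Segre variety *)

Section Segre.
Variables (F : fieldType) (p q r : nat).

Let rk (i : 'I_p) (j : 'I_q) (k : 'I_r) : 'I_(ambient_dim p q r) :=
  enum_rank (i, j, k).

Lemma flatten_hypermatrixE (A : hypermatrix F p q r) i j k :
  flatten_hypermatrix A 0 (enum_rank (i, j, k)) = A i j k.
Proof. by rewrite mxE enum_rankK. Qed.

Lemma sum_ambient (f : 'I_(ambient_dim p q r) -> F) :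
  \sum_l f l = \sum_i \sum_j \sum_k f (enum_rank (i, j, k)).
Proof.
rewrite (reindex enum_rank) /=; last exact/onW_bij/enum_rank_bij.
by rewrite pair_bigA pair_bigA /=; apply: eq_bigr => -[[i j] k] _.
Qed.

(* Near the point (x, y, z) the Segre variety is cut out by the equations
   w_ijk * w_abc ^ 2 = w_ibc * w_ajc * w_abk, where x_a, y_b and z_c are
   nonzero; their differentials already describe the tangent space. *)
Lemma kernel_tangent_hyperplane (A : hypermatrix F p q r) x y z :
  kernel A x y z -> flatten_hypermatrix A != 0 ->
  tangent_hyperplane (@segre F p q r) (flatten_hypermatrix A).
Proof.
move=> [[x_neq0 y_neq0 z_neq0] [Axy Axz Ayz]] A_neq0; split=> //.
set w := flatten_hypermatrix (fun i j k => x 0 i * y 0 j * z 0 k).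
exists w; first by exists x, y, z.
move=> v v_tan.
have /rV0Pn[a xa] := x_neq0; have /rV0Pn[b yb] := y_neq0.
have /rV0Pn[c zc] := z_neq0.
pose W i j k := w 0 (rk i j k); pose V i j k := v 0 (rk i j k).
have WE i j k : W i j k = x 0 i * y 0 j * z 0 k by apply: flatten_hypermatrixE.
have diff i j k : V i j k * W a b c ^+ 2 + 2 * W i j k * W a b c * V a b c =
    V i b c * W a j c * W a b k + W i b c * V a j c * W a b k +
    W i b c * W a j c * V a b k.
  pose X i j k : {mpoly F[ambient_dim p q r]} := 'X_(rk i j k).
  pose f := X i j k * X a b c ^+ 2 - X i b c * X a j c * X a b k.
  have dX i' j' k' : \sum_l ((X i' j' k')^`M(l)).@[w 0] * v 0 l = V i' j' k'.
    rewrite (bigD1 (rk i' j' k')) //= big1 => [|l l_ijk].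
      by rewrite mderivXU eqxx meval1 mul1r addr0.
    by rewrite mderivXU eq_sym (negPf l_ijk) meval0 mul0r.
  have f_van : in_vanishing_ideal (@segre F p q r) f.
    move=> _ [x' [y' [z' [_ ->]]]].
    by rewrite mevalB !mevalM !mevalXU !flatten_hypermatrixE; ring.
  apply/eqP; rewrite -subr_eq0; apply/eqP; rewrite -[RHS](v_tan f f_van).
  transitivity (\sum_l
     (((X i j k)^`M(l)).@[w 0] * v 0 l * W a b c ^+ 2
     + 2 * W i j k * W a b c * (((X a b c)^`M(l)).@[w 0] * v 0 l)
     - ((((X i b c)^`M(l)).@[w 0] * v 0 l) * (W a j c * W a b k)
     + (((X a j c)^`M(l)).@[w 0] * v 0 l) * (W i b c * W a b k)
     + (((X a b k)^`M(l)).@[w 0] * v 0 l) * (W i b c * W a j c)))).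
    by rewrite sumrB !big_split /= -!mulr_suml -!mulr_sumr !dX; ring.
  apply: eq_bigr => l _.
  have WX i' j' k' : (X i' j' k').@[w 0] = W i' j' k' by apply: mevalXU.
  by rewrite /f expr2 mderivB !mderivM !(mevalB, mevalD, mevalM) !WX; ring.
have Wabc : W a b c != 0 by rewrite WE !mulf_neq0.
apply/(mulIf (expf_neq0 2 Wabc)); rewrite mul0r sum_ambient.
(* The kernel equations kill every sum whose weight depends only on the index left free. *)
have sum_yz (g : 'I_p -> F) :
    \sum_i \sum_j \sum_k g i * (A i j k * y 0 j * z 0 k) = 0.
  rewrite big1 // => i _; apply: etrans (_ : g i * 0 = 0); last exact: mulr0.
  rewrite -[in RHS](Ayz i) mulr_sumr.
  by apply: eq_bigr => j _; rewrite mulr_sumr.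
have sum_xz (g : 'I_q -> F) :
    \sum_i \sum_j \sum_k g j * (A i j k * x 0 i * z 0 k) = 0.
  rewrite exchange_big big1 // => j _.
  apply: etrans (_ : g j * 0 = 0); last exact: mulr0.
  rewrite -[in RHS](Axz j) mulr_sumr.
  by apply: eq_bigr => i _; rewrite mulr_sumr.
have sum_xy (g : 'I_r -> F) :
    \sum_i \sum_j \sum_k g k * (A i j k * x 0 i * y 0 j) = 0.
  under eq_bigr => i _ do rewrite exchange_big.
  rewrite exchange_big big1 // => k _.
  apply: etrans (_ : g k * 0 = 0); last exact: mulr0.
  rewrite -[in RHS](Axy k) mulr_sumr.
  by apply: eq_bigr => i _; rewrite mulr_sumr.
(* Solving [diff] for [V i j k * W a b c ^+ 2] gives one term for each of these weights; the term in
   [W i j k] is absorbed into [g1]. *)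
pose g1 i := x 0 a ^+ 2 * y 0 b * z 0 c * V i b c -
  2 * x 0 i * W a b c * V a b c.
pose g2 j := x 0 a * y 0 b ^+ 2 * z 0 c * V a j c.
pose g3 k := x 0 a * y 0 b * z 0 c ^+ 2 * V a b k.
transitivity (\sum_i \sum_j \sum_k g1 i * (A i j k * y 0 j * z 0 k) +
  \sum_i \sum_j \sum_k g2 j * (A i j k * x 0 i * z 0 k) +
  \sum_i \sum_j \sum_k g3 k * (A i j k * x 0 i * y 0 j)); last first.
  by rewrite sum_yz sum_xz sum_xy !addr0.
rewrite mulr_suml -!big_split; apply: eq_bigr => i _ /=.
rewrite mulr_suml -!big_split; apply: eq_bigr => j _ /=.
rewrite mulr_suml -!big_split; apply: eq_bigr => k _ /=.
rewrite flatten_hypermatrixE -[LHS]mulrA -[v 0 _]/(V i j k).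
have /(canRL (addrK _)) -> := diff i j k.
by rewrite /g1 /g2 /g3 !WE; ring.
Qed.

End Segre.

(** * Vanishing of the hyperdeterminant and permutation of the indices *)

Lemma Det_degenerate (F : fieldType) (p q r : nat) (A : hypermatrix F p q r)
    (D : {mpoly F[ambient_dim p q r]}) :
  degenerate A -> (exists i j k, A i j k != 0) ->
  is_hyperdeterminant D -> Det D A = 0.
Proof.
move=> [x [y [z Axyz]]] [i [j [k Aijk]]] D_gen.
have A_neq0 : flatten_hypermatrix A != 0.
  apply: contraNneq Aijk => /rowP /(_ (enum_rank (i, j, k))).
  by rewrite flatten_hypermatrixE mxE => ->.
have D_van : in_vanishing_ideal (dual_variety (@segre F p q r)) D.
  by apply/D_gen; exists 1; rewrite mul1r.
apply: D_van; split=> // f; apply.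
exact: kernel_tangent_hyperplane Axyz A_neq0.
Qed.

Lemma degenerate_swap12 (F : fieldType) (p q r : nat)
    (A : hypermatrix F p q r) :
  degenerate (fun j i k => A i j k) -> degenerate A.
Proof.
move=> [y [x [z [[y_neq0 x_neq0 z_neq0] [Axy Ayz Axz]]]]].
exists x, y, z; split=> //; split=> // k.
rewrite exchange_big -[RHS](Axy k); apply: eq_bigr => j _.
by apply: eq_bigr => i _; rewrite mulrAC.
Qed.

Lemma degenerate_rot (F : fieldType) (p q r : nat) (A : hypermatrix F p q r) :
  degenerate (fun k i j => A i j k) -> degenerate A.
Proof.
move=> [z [x [y [[z_neq0 x_neq0 y_neq0] [Axz Ayz Axy]]]]].
exists x, y, z; split=> //; split=> [k | j | i] //.
- rewrite -[RHS](Axz j) exchange_big; apply: eq_bigr => k _.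
  by apply: eq_bigr => i _; rewrite mulrAC.
- rewrite -[RHS](Ayz i) exchange_big; apply: eq_bigr => k _.
  by apply: eq_bigr => j _; rewrite mulrAC.
Qed.

Theorem proposition3p6 (R : realType) (p q r : nat)
    (hp : (2 <= p)%N) (hpq : (p <= q)%N) (hqr : (q <= r)%N)
    (A : hypermatrix R[i] p q r)
    (hdeg :
      (exists P : 'rV[R[i]]_p,
         degenerate_point (matL A) P /\ ~ bidegenerate_point (matL A) P) \/
      (exists Q : 'rV[R[i]]_q,
         degenerate_point (matM A) Q /\ ~ bidegenerate_point (matM A) Q) \/
      (exists T : 'rV[R[i]]_r,
         degenerate_point (matN A) T /\ ~ bidegenerate_point (matN A) T)) :
  degenerate A /\
  ((r <= p + q - 1)%N ->
   forall D : {mpoly R[i][ambient_dim p q r]},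
     is_hyperdeterminant D -> Det D A = 0).
Proof.
suff [A_deg A_neq0] : degenerate A /\ exists i j k, A i j k != 0.
  by split=> // _ D; apply: Det_degenerate.
have [[P [degP nbiP]] | [[Q [degQ nbiQ]] | [T [degT nbiT]]]] := hdeg.
- by apply: degenerate_matL degP nbiP; rewrite (leq_trans hp).
(* [matM A] and [matN A] are, by conversion, [matL] of the hypermatrix with its indices permuted. *)
- have [|A_deg [j [i [k Aijk]]]] :=
    @degenerate_matL _ _ _ _ (fun j i k => A i j k) Q _ degQ nbiQ.
    by rewrite hp (leq_trans hpq).
  by split; [apply: degenerate_swap12 | exists i, j, k].
have [|A_deg [k [i [j Aijk]]]] :=
  @degenerate_matL _ _ _ _ (fun k i j => A i j k) T _ degT nbiT.
  by rewrite hp.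
by split; [apply: degenerate_rot | exists i, j, k].
Qed.
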